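(* Let $F$ be an Archimedean vector lattice. Then $F$ is atomic if and only if uo convergence on $F$ is topological.
   Context: An element $f>0$ of a vector lattice $F$ is an atom if $[0,f]=\{g\in F : 0\le g\le f\}$ consists of scalar multiples of $f$; $F$ is atomic if for every $g>0$ the interval $[0,g]$ contains an atom. A net $(p_\alpha)$ in $F$ order converges to $p\in F$ (written $p_\alpha\to p$) if there are an increasing net $(q_\beta)_{\beta\in B}$ and a decreasing net $(r_\beta)_{\beta\in B}$ in $F$ with $\bigvee_\beta q_\beta=p=\bigwedge_\beta r_\beta$ such that for every $\beta$ there is $\alpha_0$ with $q_\beta\le p_\alpha\le r_\beta$ for all $\alpha\ge\alpha_0$. A net $(f_\alpha)$ in $F$ unbounded order (uo) converges to $f\in F$ if $|f_\alpha-f|\wedge h\to 0$ for every $h\in F_+$. uo convergence on $F$ is topological if there is a topology on $F$ such that a net in $F$ uo converges to $f\in F$ iff it converges to $f$ in this topology. *)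

(* Defs.v *)
From HB Require Import structures.
From mathcomp Require Import all_boot all_order all_algebra.
From mathcomp Require Import all_classical all_reals topology.

Set Implicit Arguments.
Unset Strict Implicit.
Unset Printing Implicit Defensive.

Import Order.TTheory GRing.Theory Num.Theory.

Local Open Scope classical_set_scope.
Local Open Scope ring_scope.

(* The lattice operations are fields here rather than inherited from
   latticeType: realDomainType already joins additive groups with lattices and
   MathComp declares no intermediate join, so HB rejects a structure that
   inherits from both lmodType and latticeType. *)
HB.mixin Record isVectorLattice (R : numDomainType) (F : Type)
    & GRing.Lmodule R F & Num.POrderedZmodule F := {
  vmeet : F -> F -> F ;
  vjoin : F -> F -> F ;
  vmeet_glb : forall h f g : F, (h <= vmeet f g) = (h <= f) && (h <= g) ;
  vjoin_lub : forall f g h : F, (vjoin f g <= h) = (f <= h) && (g <= h) ;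
  vlat_leD2r : forall h f g : F, f <= g -> f + h <= g + h ;
  vlat_scale_ge0 : forall (a : R) (f : F), 0 <= a -> 0 <= f -> 0 <= a *: f
}.

#[short(type="vectorLatticeType")]
HB.structure Definition VectorLattice (R : numDomainType) :=
  { F of GRing.Lmodule R F & Num.POrderedZmodule F & isVectorLattice R F }.

(* Index sets of nets: nonempty directed preorders. *)
Record directedSet := DirectedSet {
  dset_sort :> Type ;
  dle : dset_sort -> dset_sort -> Prop ;
  dset_inhabited : inhabited dset_sort ;
  dle_refl : forall a, dle a a ;
  dle_trans : forall a b c, dle a b -> dle b c -> dle a c ;
  dle_directed : forall a b, exists c, dle a c /\ dle b c
}.

(* The filter generated by the tails of a directed set; a net p : A -> T has
   limit l in a topological space T when p @ tails A --> l. *)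
Definition tails (A : directedSet) : set_system A :=
  [set E | exists a0, forall a, dle a0 a -> E a].
Arguments tails : clear implicits.

Section VectorLatticeDefs.
Context {R : realType} {F : vectorLatticeType R}.
Implicit Types (f g h l : F) (A : directedSet).

Definition vlat_abs f : F := vjoin f (- f).

Definition atom f : Prop :=
  0 < f /\ forall g, 0 <= g <= f -> exists a : R, g = a *: f.

Definition increasing_net A (q : A -> F) : Prop :=
  forall a b, dle a b -> q a <= q b.

Definition decreasing_net A (r : A -> F) : Prop :=
  forall a b, dle a b -> r b <= r a.

Definition order_cvg A (p : A -> F) l : Prop :=
  exists (B : directedSet) (q r : B -> F),
    [/\ increasing_net q, decreasing_net r,
        supremums (range q) l, infimums (range r) l
      & forall b, exists a0, forall a, dle a0 a -> q b <= p a <= r b].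

Definition uo_cvg A (p : A -> F) l : Prop :=
  forall h, 0 <= h ->
    order_cvg (fun a => vmeet (vlat_abs (p a - l)) h) 0.

End VectorLatticeDefs.

Section VectorLatticeProperties.
Context {R : realType} (F : vectorLatticeType R).

Definition archimedean : Prop :=
  forall f g : F, (forall n : nat, f *+ n.+1 <= g) -> f <= 0.

Definition atomic : Prop :=
  forall g : F, 0 < g -> exists f : F, 0 <= f <= g /\ atom f.

(* A topology on F is an arbitrary topologicalType structure on the carrier
   of F; it need not be related to the algebraic or order structure. *)
Definition uo_topological : Prop :=
  exists tau : Topological F,
    let T : topologicalType := Topological.Pack tau in
    forall (A : directedSet) (p : A -> F) (l : F),
      uo_cvg p l <-> (p : A -> T) @ tails A --> (l : T).

End VectorLatticeProperties.

(* Main.v *)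
(* If F is atomic, uo convergence is convergence in the topology whose
   neighbourhoods of x are generated by the sets {y | |y - x| /\ a <= e a} with
   a an atom and e > 0.

   Conversely, suppose that a topology gives uo convergence and that no atom
   lies below g > 0. The net of all points of all neighbourhoods of 0 converges
   to 0, so some neighbourhood U has an upper bound r for the |x| /\ g with
   x in U, where w = (g - r)^+ > 0. Follow an ultrafilter of the Stone space
   of w, that is, elements x in (0, w] which shrink to a point. Since w
   dominates no atom, every c > 0 has a part d > 0 which is eventually disjoint
   from x, so any net of multiples n(x) x uo converges to 0 and thus enters U.
   But n(x) can be chosen such that n(x) x /\ g <= r fails. *)
Require Import Defs.
From HB Require Import structures.
From mathcomp Require Import all_boot all_order all_algebra.
From mathcomp Require Import all_classical all_reals topology.

Set Implicit Arguments.
Unset Strict Implicit.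
Unset Printing Implicit Defensive.

Import Order.TTheory GRing.Theory Num.Theory.

Local Open Scope classical_set_scope.
Local Open Scope ring_scope.

(** * Elementary inequalities in vector lattices *)

Section VectorLatticeTheory.
Context {R : realType} {F : vectorLatticeType R}.
Implicit Types (f g h x y z : F) (t : R).

Lemma vleD2r h f g : (f + h <= g + h) = (f <= g).
Proof.
apply/idP/idP => [|/vlat_leD2r//].
by move=> /(vlat_leD2r (- h)); rewrite !addrK.
Qed.

Lemma vleBlDr f g h : (f - h <= g) = (f <= g + h).
Proof. by rewrite -(vleD2r h (f - h)) subrK. Qed.

Lemma vleBrDr f g h : (f <= g - h) = (f + h <= g).
Proof. by rewrite -(vleD2r h f) subrK. Qed.

Lemma vsubr_ge0 f g : (0 <= g - f) = (f <= g).
Proof. by rewrite vleBrDr add0r. Qed.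

Lemma vleN2 f g : (- f <= - g) = (g <= f).
Proof. by rewrite -(vleD2r f (- f)) addNr addrC vsubr_ge0. Qed.

Lemma vleD f1 g1 f2 g2 : f1 <= g1 -> f2 <= g2 -> f1 + f2 <= g1 + g2.
Proof.
move=> le1 le2; apply: (@le_trans _ _ (g1 + f2)); first by rewrite vleD2r.
by rewrite ![g1 + _]addrC vleD2r.
Qed.

Lemma vaddr_ge0 f g : 0 <= f -> 0 <= g -> 0 <= f + g.
Proof. by move=> f0 g0; rewrite -[0]addr0 vleD. Qed.

Lemma vle_wpDr f g : 0 <= g -> f <= f + g.
Proof. by move=> g0; rewrite -[leLHS]addr0 vleD. Qed.

Lemma vmulrn_ge0 f n : 0 <= f -> 0 <= f *+ n.
Proof.
by move=> f0; elim: n => [|n IH]; rewrite ?mulr0n// mulrS vaddr_ge0.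
Qed.

Lemma vler_wpM2l t f g : 0 <= t -> f <= g -> t *: f <= t *: g.
Proof.
by move=> t0; rewrite -vsubr_ge0 => fg; rewrite -vsubr_ge0 -scalerBr vlat_scale_ge0.
Qed.

Lemma vler_wpM2r t u f : 0 <= f -> t <= u -> t *: f <= u *: f.
Proof.
by move=> f0 tu; rewrite -vsubr_ge0 -scalerBl vlat_scale_ge0// subr_ge0.
Qed.

Lemma vscaler_gt0 t f : 0 < f -> (0 < t *: f) = (0 < t).
Proof.
move=> f0; have ff := lt_eqF f0; have [t0|t0] := ltP 0 t.
  rewrite lt_neqAle vlat_scale_ge0 ?ltW// andbT eq_sym scaler_eq0.
  by rewrite gt_eqF// eq_sym ff.
apply/negbTE/negP => tf; suff: t *: f <= 0 by rewrite (lt_geF tf).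
by rewrite -(scale0r f) vler_wpM2r// ltW.
Qed.

Lemma vler_pM2r t u f : 0 < f -> (t *: f <= u *: f) = (t <= u).
Proof.
move=> f0; apply/idP/idP => [|tu]; last by rewrite vler_wpM2r// ltW.
move=> le_tu; rewrite leNgt -subr_gt0 -(vscaler_gt0 _ f0) scalerBl.
by apply/negP => /lt_geF; rewrite vleBlDr add0r le_tu.
Qed.

Lemma vmeet_lel f g : vmeet f g <= f.
Proof. by have := vmeet_glb (vmeet f g) f g; rewrite lexx => /esym/andP[]. Qed.

Lemma vmeet_ler f g : vmeet f g <= g.
Proof. by have := vmeet_glb (vmeet f g) f g; rewrite lexx => /esym/andP[]. Qed.

Lemma vle_joinl f g : f <= vjoin f g.
Proof. by have := vjoin_lub f g (vjoin f g); rewrite lexx => /esym/andP[]. Qed.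

Lemma vle_joinr f g : g <= vjoin f g.
Proof. by have := vjoin_lub f g (vjoin f g); rewrite lexx => /esym/andP[]. Qed.

Lemma vmeetC f g : vmeet f g = vmeet g f.
Proof. by apply: le_anti; rewrite !vmeet_glb !vmeet_lel !vmeet_ler. Qed.

Lemma vmeet_l f g : f <= g -> vmeet f g = f.
Proof. by move=> fg; apply: le_anti; rewrite vmeet_lel vmeet_glb lexx. Qed.

Lemma vle_meet f1 g1 f2 g2 : f1 <= f2 -> g1 <= g2 -> vmeet f1 g1 <= vmeet f2 g2.
Proof.
move=> lef leg; rewrite vmeet_glb (le_trans (vmeet_lel _ _) lef).
exact: le_trans (vmeet_ler _ _) leg.
Qed.

Lemma vmeet_ge0 f g : 0 <= f -> 0 <= g -> 0 <= vmeet f g.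
Proof. by move=> f0 g0; rewrite vmeet_glb f0. Qed.

Lemma vmeetDr_le x y z : 0 <= x -> 0 <= y -> 0 <= z ->
  vmeet x (y + z) <= vmeet x y + vmeet x z.
Proof.
move=> x0 y0 z0; rewrite -vleBlDr vmeet_glb !vleBlDr; apply/andP; split.
  exact: le_trans (vmeet_lel _ _) (vle_wpDr _ (vmeet_ge0 x0 z0)).
rewrite [leRHS]addrC -vleBlDr vmeet_glb !vleBlDr [z + y]addrC vmeet_ler andbT.
exact: le_trans (vmeet_lel _ _) (vle_wpDr _ y0).
Qed.

Lemma vmeet0_mulrn x y n : 0 <= x -> 0 <= y -> vmeet x y = 0 ->
  vmeet x (y *+ n) = 0.
Proof.
move=> x0 y0 xy; elim: n => [|n IH]; first by rewrite vmeetC vmeet_l.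
apply: le_anti; rewrite vmeet_ge0 ?vmulrn_ge0// andbT mulrS.
by rewrite (le_trans (vmeetDr_le _ _ _))// ?vmulrn_ge0// xy IH addr0.
Qed.

(** * Positive parts, absolute values and disjointness *)

Definition vpos f := vjoin f 0.

Lemma vpos_ge0 f : 0 <= vpos f. Proof. exact: vle_joinr. Qed.

Lemma vpos_le f g : 0 <= g -> (vpos f <= g) = (f <= g).
Proof. by move=> g0; rewrite vjoin_lub g0 andbT. Qed.

Lemma vpos_gt0 f : (0 < vpos f) = ~~ (f <= 0).
Proof.
by rewrite lt_def vpos_ge0 andbT -[f <= 0]vpos_le// eq_le vpos_ge0 andbT.
Qed.

Lemma vpos_id f : 0 <= f -> vpos f = f.
Proof. by move=> f0; apply: le_anti; rewrite vpos_le// lexx vle_joinl. Qed.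

Lemma vposN f : vpos (- f) = vpos f - f.
Proof.
apply: le_anti; rewrite vpos_le ?vsubr_ge0 ?vle_joinl//; apply/andP; split.
  by rewrite vleBrDr addNr vpos_ge0.
rewrite vleBlDr vpos_le -?vleBlDr ?add0r ?subrr ?vpos_ge0//.
exact: vle_joinl.
Qed.

(** Since [m <= vpos f] and [f + m <= vpos f], the element [vpos f - m] is above both [0] and [f],
    hence above [vpos f]. *)
Lemma vpos_meetN f : vmeet (vpos f) (vpos (- f)) = 0.
Proof.
set m := vmeet _ _.
have m0 : 0 <= m by rewrite vmeet_ge0 ?vpos_ge0.
apply: le_anti; rewrite m0 andbT -(vleD2r (vpos f)) add0r addrC -vleBrDr.
rewrite vpos_le vleBrDr ?add0r ?vmeet_lel//.
by rewrite addrC -vleBrDr -vposN vmeet_ler.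
Qed.

(** From [f - vpos (f - g) <= vmeet f g <= 0] follows [f <= vpos (f - g)]; with the symmetric bound
    on [g] this reduces to [vpos_meetN]. *)
Lemma vpos_meet0 f g : vmeet f g <= 0 -> vmeet (vpos f) (vpos g) = 0.
Proof.
have le_posB f1 g1 : vmeet f1 g1 <= 0 -> f1 <= vpos (f1 - g1).
  move=> fg0; rewrite -[leRHS]add0r -vleBlDr (le_trans _ fg0)// vmeet_glb.
  by rewrite vleBlDr vle_wpDr ?vpos_ge0// vleBlDr addrC -vleBlDr vle_joinl.
move=> fg0; apply: le_anti; rewrite vmeet_ge0 ?vpos_ge0// andbT.
rewrite -(vpos_meetN (f - g)) vle_meet// vpos_le ?vpos_ge0// ?opprB le_posB//.
by rewrite vmeetC.
Qed.

Lemma vabs_le f g : (vlat_abs f <= g) = (f <= g) && (- f <= g).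
Proof. exact: vjoin_lub. Qed.

Lemma vabs_ge0 f : 0 <= vlat_abs f.
Proof.
have : 0 <= vlat_abs f + vlat_abs f.
  by rewrite -[leLHS](subrr f) vleD ?vle_joinl ?vle_joinr.
move=> /(@vlat_scale_ge0 _ F 2^-1); rewrite invr_ge0 ler0n => /(_ isT).
by rewrite -mulr2n -scaler_nat scalerA mulVf ?pnatr_eq0// scale1r.
Qed.

Lemma vabs_id f : 0 <= f -> vlat_abs f = f.
Proof.
move=> f0; apply: le_anti; rewrite vle_joinl andbT vabs_le lexx /=.
by rewrite (le_trans _ f0)// -[leRHS]oppr0 vleN2.
Qed.

Lemma vabsD f g : vlat_abs (f + g) <= vlat_abs f + vlat_abs g.
Proof. by rewrite vabs_le opprD !vleD ?vle_joinl ?vle_joinr. Qed.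

Lemma vmeet0_leD x y z : vmeet x y = 0 -> x <= z -> y <= z -> x + y <= z.
Proof.
move=> xy xz yz; rewrite -[leRHS]add0r -vleBlDr -xy vmeet_glb.
by rewrite !vleBlDr vleD// addrC vleD.
Qed.

(** * Atoms *)

Lemma atom_meet a x : atom a -> 0 <= x ->
  exists2 t, 0 <= t <= 1 & vmeet x a = t *: a.
Proof.
move=> [a0 aP] x0; have xa0 := vmeet_ge0 x0 (ltW a0).
have [|t tE] := aP (vmeet x a); first by rewrite xa0 vmeet_ler.
exists t => //; rewrite -!(vler_pM2r _ _ a0) -tE scale0r scale1r xa0.
exact: vmeet_ler.
Qed.

(* Otherwise u = x + a/2 - b has u^+ = t a with t > 0, so u^- is disjoint from a
   and meeting a with b = x + u^- + (1/2 - t) a gives a <= (1 - t) a. *)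
Lemma atom_leD a x b : atom a -> 0 <= x -> vmeet x a <= 2^-1 *: a ->
  x <= b -> a <= b -> x + 2^-1 *: a <= b.
Proof.
move=> atom_a x0 xa_le xb ab; have [a0 aP] := atom_a.
rewrite -[leRHS]add0r -vleBlDr; set u := x + _ - b.
apply: contraT; rewrite -vpos_gt0 => pu0.
have half_ge0 : 0 <= 2^-1 *: a by rewrite vlat_scale_ge0 ?invr_ge0 ?ltW.
have half_le : 2^-1 *: a <= a.
  by rewrite -[leRHS]scale1r vler_pM2r// invf_le1 ?ler1n.
have pu_le : vpos u <= 2^-1 *: a by rewrite vpos_le// vleBlDr addrC vleD.
have [|t puE] := aP (vpos u); first by rewrite vpos_ge0 (le_trans pu_le).
have t0 : 0 < t by rewrite -(vscaler_gt0 _ a0) -puE.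
have t1 : t <= 2^-1 by rewrite -(vler_pM2r _ _ a0) -puE.
have v0 := vpos_ge0 (- u); have va0 := vmeet_ge0 v0 (ltW a0).
have va : vmeet (vpos (- u)) a = 0.
  apply/eqP; apply: contraT => va_neq0.
  have := vscaler_gt0 t (_ : 0 < vmeet (vpos (- u)) a).
  rewrite lt_def va_neq0 t0 => /(_ va0)/lt_geF <-.
  rewrite -(vpos_meetN u) vmeet_glb {1}puE.
  rewrite vler_wpM2l ?vmeet_ler ?(ltW t0)//=.
  rewrite (le_trans _ (vmeet_lel _ a))// -[leRHS]scale1r vler_wpM2r//.
  by rewrite (le_trans t1)// invf_le1 ?ler1n.
have bE : b = x + (vpos (- u) + (2^-1 - t) *: a).
  by rewrite vposN puE scalerBl [_ + (_ - _)]addrC subrKA addrA subKr.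
have ht0 : 0 <= (2^-1 - t) *: a by rewrite vlat_scale_ge0 ?subr_ge0// ltW.
have : a <= (1 - t) *: a.
  rewrite -[leLHS](vmeet_l ab) bE.
  apply: le_trans (vmeetDr_le _ _ _) _; rewrite ?vaddr_ge0 ?(ltW a0)//.
  have -> : 1 - t = 2^-1 + (2^-1 - t) by rewrite addrA -div1r -splitr.
  rewrite [leRHS]scalerDl; apply: vleD; first by rewrite vmeetC.
  apply: le_trans (vmeetDr_le _ _ _) _; rewrite ?(ltW a0)//.
  by rewrite vmeetC va add0r vmeet_ler.
rewrite -[leLHS]scale1r vler_pM2r// => {}t1; exfalso; move: t1.
by rewrite lerBrDr gerDl lt_geF.
Qed.

(** * Consequences of the Archimedean property *)

Context (archF : archimedean F).

Lemma archimedean_le0 f g : (forall t, 0 < t -> f <= t *: g) -> f <= 0.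
Proof.
move=> fg; apply: (@archF _ g) => n.
have /fg/(vler_wpM2l (ler0n R n.+1)) : 0 < n.+1%:R^-1 :> R by rewrite invr_gt0.
by rewrite scaler_nat scalerA mulfV ?pnatr_eq0// scale1r.
Qed.

(** Let [f] in [[0, c]] be no multiple of [c]. For [0 < t < 1] the positive and negative parts of
    [f - t *: c] are disjoint and below [c], so without a splitting one of them vanishes. Then [f]
    is comparable with every [t *: c], and the cut at [sup T] forces [f = sup T *: c]. *)
Lemma non_atom_split (c : F) : 0 < c -> ~ atom c ->
  exists c1 c2, [/\ 0 < c1 <= c, 0 < c2 <= c & vmeet c1 c2 = 0].
Proof.
move=> c0 /not_andP[//|/existsNP[f /not_implyP[/andP[f0 fc] fnc]]].
apply: contrapT => nsplit; apply: fnc.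
have dich t : t *: c <= f \/ f <= t *: c.
  have [t0|t0] := leP t 0.
    by left; rewrite (le_trans _ f0)// -(scale0r c) vler_pM2r.
  have [t1|t1] := leP 1 t.
    by right; rewrite (le_trans fc)// -[leLHS]scale1r vler_pM2r.
  have [|ntf] := boolP (t *: c <= f); [by left|right].
  apply: contraT => nft; case: nsplit.
  exists (vpos (f - t *: c)), (vpos (- (f - t *: c))).
  have tc : t *: c <= c by rewrite -[leRHS]scale1r vler_pM2r// ltW.
  have tc0 : 0 <= t *: c by rewrite vlat_scale_ge0// ltW.
  rewrite !vpos_gt0 opprB !vleBlDr !add0r nft ntf !vpos_le ?(ltW c0)//.
  by rewrite !vleBlDr -opprB vpos_meetN !(le_trans _ (vle_wpDr _ _)).
pose T := [set t | t *: c <= f].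
have T0 : T 0 by rewrite /T/= scale0r.
have T1 : ubound T 1.
  by move=> t Tt; rewrite -(vler_pM2r _ _ c0) scale1r (le_trans Tt).
have supT : has_sup T by split; [exists 0|exists 1].
exists (sup T); apply/eqP; rewrite -subr_eq0; apply/eqP/le_anti/andP; split.
  apply: (@archimedean_le0 _ c) => t t0.
  have [Tt|] := dich (sup T + t).
    have := sup_upper_bound supT Tt.
    by rewrite gerDl => /(lt_le_trans t0); rewrite ltxx.
  by rewrite vleBlDr scalerDl addrC.
rewrite -vleN2 oppr0 opprB.
apply: (@archimedean_le0 _ c) => t t0.
have [u Tu /ltW ut] := sup_adherent t0 supT.
rewrite vleBlDr [leRHS]addrC -vleBlDr -scalerBl.
by apply: le_trans Tu; rewrite vler_pM2r.
Qed.

(** If [vmeet (x *+ n) g <= r] for all [n], then [vpos (x *+ n - r)] is disjoint from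
    [vpos (g - r)], thus from [x] and from [x *+ n]. Being below [x *+ n], it is zero, so all
    multiples of [x] stay below [r]. *)
Lemma not_le_meet_mulrn x g r : 0 <= r -> 0 < x -> x <= vpos (g - r) ->
  exists n, ~ vmeet (x *+ n) g <= r.
Proof.
move=> r0 x0 xgr; apply/existsNP => le_r.
have x_ge0 := ltW x0.
suff xr n : x *+ n.+1 <= r by have := lt_geF x0; rewrite (archF xr).
have disj : vmeet (vpos (x *+ n.+1 - r)) (vpos (g - r)) = 0.
  apply: vpos_meet0; rewrite -[leRHS](subrr r) vleBrDr.
  by rewrite (le_trans _ (le_r n.+1))// vmeet_glb -!vleBrDr vmeet_lel vmeet_ler.
have P0 := vpos_ge0 (x *+ n.+1 - r).
have Px : vmeet (vpos (x *+ n.+1 - r)) (x *+ n.+1) = 0.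
  apply: vmeet0_mulrn => //; apply: le_anti.
  by rewrite vmeet_ge0// andbT -disj vle_meet.
rewrite -[leRHS]add0r -vleBlDr -vpos_le// -Px vmeet_glb lexx vpos_le ?vmulrn_ge0//.
by rewrite vleBlDr vle_wpDr.
Qed.

End VectorLatticeTheory.

(** * Order convergence through eventual upper bounds *)

Section Nets.
Context {R : realType} {F : vectorLatticeType R}.
Context (archF : archimedean F).
Context (A : directedSet) (p : A -> F).

Lemma eventually_and (P Q : A -> Prop) :
  (exists a0, forall a, dle a0 a -> P a) ->
  (exists a0, forall a, dle a0 a -> Q a) ->
  exists a0, forall a, dle a0 a -> P a /\ Q a.
Proof.
move=> [a aP] [b bQ]; have [c [ac bc]] := dle_directed a b.
by exists c => d cd; split; [apply: aP|apply: bQ]; exact: dle_trans cd.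
Qed.

Definition eventual_ub : set F :=
  [set b | exists a0, forall a, dle a0 a -> p a <= b].

Lemma eventual_ub_meet b b' :
  eventual_ub b -> eventual_ub b' -> eventual_ub (vmeet b b').
Proof.
move=> pb pb'; have [c cP] := eventually_and pb pb'.
by exists c => a /cP[? ?]; rewrite vmeet_glb; apply/andP.
Qed.

(** The eventual upper bounds index themselves, smaller ones being later, so that [sval] is a
    decreasing net. *)
Definition eventual_ub_dset (ub0 : eventual_ub !=set0) : directedSet.
Proof.
refine (@DirectedSet {b | eventual_ub b} (fun b b' => sval b' <= sval b) _ _ _ _).
- by have [b pb] := ub0; constructor; exists b.
- by move=> b.
- by move=> a b c ab /le_trans; exact.
- move=> [b pb] [b' pb']; exists (exist _ _ (eventual_ub_meet pb pb')).
  by rewrite /= vmeet_lel vmeet_ler.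
Defined.

(* If c > 0 is below all eventual upper bounds of p, then these are stable under
   subtraction of d, so that h - n d >= 0 for all n. *)
Lemma order_cvg0 h : (forall a, 0 <= p a <= h) ->
  (forall c, 0 < c -> exists2 d, 0 < d &
    exists a0, forall a, dle a0 a ->
      forall b, p a <= b -> c <= b -> p a + d <= b) ->
  order_cvg p 0.
Proof.
move=> p0h step; have [a0] := dset_inhabited A.
have ub_h : eventual_ub h by exists a0 => a _; case/andP: (p0h a).
have ub_ge0 b : eventual_ub b -> 0 <= b.
  move=> [a /(_ a (dle_refl a))]; apply: le_trans.
  by case/andP: (p0h a).
exists (eventual_ub_dset (ex_intro _ h ub_h)), (fun=> 0), sval; split.
- by move=> b b' _.
- by move=> b b'.
- split; first by move=> _ [_ _ <-].
  by move=> x; apply; exists (exist _ h ub_h).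
- split; first by move=> _ [[b pb] _ <-]; exact: ub_ge0.
  (* Unless [c <= 0], [vpos c] is positive; it too is below every eventual upper bound, as these are
     nonnegative. *)
  move=> c lb_c; apply: contraT; rewrite -vpos_gt0 => /step[d d0 [a1 a1P]].
  suff ub_hd n : eventual_ub (h - d *+ n).
    have := archF (_ : forall n, d *+ n.+1 <= h); rewrite (lt_geF d0); apply.
    by move=> n; rewrite -vsubr_ge0 ub_ge0.
  elim: n => [|n IH]; first by rewrite subr0.
  have le_cb : vpos c <= h - d *+ n.
    by rewrite vpos_le ?ub_ge0// lb_c//; exists (exist _ _ IH).
  have [a2 a2P] := eventually_and IH (ex_intro _ a1 a1P).
  exists a2 => a /a2P[pa /(_ _ pa le_cb) pd].
  by rewrite mulrSr opprD addrA vleBrDr.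
- move=> [b [a1 pb]]; exists a1 => a /pb ->; rewrite andbT.
  by case/andP: (p0h a).
Qed.

End Nets.

(** If [d] is disjoint from [p a], it is disjoint from [vmeet (p a) h], and the sum of two disjoint
    elements is below each common upper bound. This is the step that [order_cvg0] asks for. *)
Lemma uo_cvg0_disjoint {R : realType} {F : vectorLatticeType R}
    (archF : archimedean F) (A : directedSet) (p : A -> F) :
  (forall a, 0 <= p a) ->
  (forall c, 0 < c -> exists2 d, 0 < d <= c &
    exists a0, forall a, dle a0 a -> vmeet (p a) d = 0) ->
  uo_cvg p 0.
Proof.
move=> p0 disj h h0; apply: (order_cvg0 archF (h := h)) => [a|c].
  by rewrite subr0 vabs_id// vmeet_ler andbT vmeet_ge0.
move=> /disj[d /andP[d0 dc] [a0 a0P]]; exists d => //; exists a0 => a /a0P pd b.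
rewrite subr0 vabs_id// => pb cb; apply: vmeet0_leD => //; last exact: le_trans cb.
apply: le_anti; rewrite !vmeet_ge0 ?(ltW d0)// andbT -pd vle_meet//.
exact: vmeet_lel.
Qed.

(** * Filters as nets *)

Section FilterNet.
Context {T : Type} (G : set_system T) (FG : ProperFilter G).

(** The order compares only the sets, so the tail at [(E, x)] reaches every point of [E]. With one
    chosen point per set the tails could generate a filter finer than [G]. *)
Definition filter_dset : directedSet.
Proof.
refine (@DirectedSet {Ex : set T * T | G Ex.1 /\ Ex.1 Ex.2}
  (fun u v => (sval v).1 `<=` (sval u).1) _ _ _ _).
- have [x _] := filter_ex (@filterT _ G _).
  by constructor; exists (setT, x); split=> //; exact: filterT.
- by move=> u.
- by move=> u v w vu wv; exact: subset_trans vu.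
- move=> [[D x] [/= GD Dx]] [[E y] [/= GE Ey]].
  have GDE : G (D `&` E) by exact: filterI.
  have [z DEz] := filter_ex GDE.
  by exists (exist _ (D `&` E, z) (conj GDE DEz)); split=> t [].
Defined.

Definition filter_net (u : filter_dset) : T := (sval u).2.

Lemma filter_net_tails : filter_net @ tails filter_dset = G.
Proof.
apply/seteqP; split=> E.
  move=> [[[D x] /= GDx] DE]; apply: filterS GDx.1 => y Dy.
  by apply: (DE (exist _ (D, y) (conj GDx.1 Dy))).
move=> GE; have [x Ex] := filter_ex GE.
exists (exist _ (E, x) (conj GE Ex)) => -[[D y] [/= GD Dy]] /=; exact.
Qed.

End FilterNet.
Arguments filter_net {T G} FG u.

(** * The topology generated by the atoms, carried by an alias of [F] *)

Definition atom_topology {R : realType} (F : vectorLatticeType R) : Type := F.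

Section AtomTopology.
Context {R : realType} (F : vectorLatticeType R).
Local Notation T := (atom_topology F).

Definition atom_ball (x : F) (s : seq F) (e : R) : set F :=
  [set y | forall a, a \in s -> vmeet (vlat_abs (y - x)) a <= e *: a].

Definition atom_nbhs (x : T) : set_system T :=
  [set E | exists s (e : R), [/\ forall a, a \in s -> atom a, 0 < e &
    atom_ball x s e `<=` E]].

HB.instance Definition _ := Choice.on T.
HB.instance Definition _ := hasNbhs.Build T atom_nbhs.

Lemma atom_ball_center x s (e : R) : (forall a, a \in s -> atom a) -> 0 < e ->
  atom_ball x s e x.
Proof.
move=> sA e0 a /sA[a0 _]; rewrite subrr vabs_id// vmeet_l ?ltW//.
by rewrite vscaler_gt0.
Qed.

(** This is the triangle inequality: meeting with [a] is monotone, and subadditive on nonnegative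
    elements. *)
Lemma atom_ball_split x y z s (e : R) : (forall a, a \in s -> atom a) ->
  atom_ball x s (e / 2) y -> atom_ball y s (e / 2) z -> atom_ball x s e z.
Proof.
move=> sA xy yz a sa; have [/ltW a0 _] := sA _ sa.
rewrite [e]splitr scalerDl (le_trans _ (vleD (yz _ sa) (xy _ sa)))//.
rewrite ![vmeet _ a]vmeetC (le_trans _ (vmeetDr_le _ _ _))// ?vabs_ge0//.
by rewrite vle_meet// -[z - x](subrKA y) vabsD.
Qed.

Lemma atom_nbhs_filter (x : T) : ProperFilter (nbhs x).
Proof.
apply: Build_ProperFilter_ex.
  by move=> E [s [e [sA e0 sE]]]; exists x; apply: sE; exact: atom_ball_center.
split.
- by exists [::], 1; split.
- move=> D E [s [e [sA e0 sD]]] [s' [e' [s'A e'0 s'E]]].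
  exists (s ++ s'), (Num.min e e'); split; rewrite ?lt_min ?e0//.
    by move=> a; rewrite mem_cat => /orP[/sA|/s'A].
  move=> y By; split; [apply: sD|apply: s'E] => a sa.
    have [/ltW a0 _] := sA _ sa; have := By a; rewrite mem_cat sa => /(_ isT).
    by move/le_trans; apply; rewrite vler_wpM2r// ge_min lexx.
  have [/ltW a0 _] := s'A _ sa; have := By a; rewrite mem_cat sa orbT => /(_ isT).
  by move/le_trans; apply; rewrite vler_wpM2r// ge_min lexx orbT.
- move=> D E DE [s [e [sA e0 sD]]]; exists s, e; split=> //.
  exact: subset_trans DE.
Qed.

Lemma atom_nbhs_singleton (x : T) (E : set T) : nbhs x E -> E x.
Proof. by move=> [s [e [sA e0 sE]]]; apply: sE; exact: atom_ball_center. Qed.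

Lemma atom_nbhs_nbhs (x : T) (E : set T) : nbhs x E -> nbhs x (nbhs^~ E).
Proof.
move=> [s [e [sA e0 sE]]]; have e20 : 0 < e / 2 by rewrite divr_gt0.
exists s, (e / 2); split=> // y xy; exists s, (e / 2); split=> // z yz.
exact/sE/(atom_ball_split sA xy).
Qed.

HB.instance Definition _ := Nbhs_isNbhsTopological.Build T
  atom_nbhs_filter atom_nbhs_singleton atom_nbhs_nbhs.

(** A basic neighbourhood involves finitely many atoms, so only finitely many tails have to be
    intersected. *)
Lemma cvg_atom_topologyP (A : directedSet) (p : A -> F) (l : F) :
  ((p : A -> T) @ tails A --> (l : T)) <->
  forall a, atom a -> forall e : R, 0 < e -> exists a0, forall i, dle a0 i ->
    vmeet (vlat_abs (p i - l)) a <= e *: a.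
Proof.
split=> [pl a atom_a e e0|pl E [s [e [sA e0 sE]]]].
  have [|i0 iP] := pl (atom_ball l [:: a] e).
    by exists [:: a], e; split=> // b; rewrite inE => /eqP ->.
  by exists i0 => i /iP; apply; rewrite inE.
suff [i0 iP] : exists i0, forall i, dle i0 i -> atom_ball l s e (p i).
  by exists i0 => i /iP/sE.
elim: s sA {sE} => [|a s IH] sA.
  by have [i0] := dset_inhabited A; exists i0.
have atom_a : atom a by apply: sA; rewrite inE eqxx.
have /IH s_ev : forall b, b \in s -> atom b.
  by move=> b bs; apply: sA; rewrite inE bs orbT.
have [i0 i0P] := eventually_and (pl a atom_a e e0) s_ev.
by exists i0 => i /i0P[pa ps] b; rewrite inE => /orP[/eqP ->//|]; exact: ps.
Qed.

End AtomTopology.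

(** * The two implications *)

Section UoTopological.
Context {R : realType} (F : vectorLatticeType R).
Context (archF : archimedean F).

(** Test the convergence against [h = a]. Each [vmeet (r b) a] is a multiple of [a]; if none were at
    most [e *: a], then [e *: a > 0] would be a lower bound of [r], whose infimum is [0]. *)
Lemma uo_cvg_atom (A : directedSet) (p : A -> F) l a (e : R) :
  uo_cvg p l -> atom a -> 0 < e ->
  exists a0, forall i, dle a0 i -> vmeet (vlat_abs (p i - l)) a <= e *: a.
Proof.
move=> pl atom_a e0; have [a0 _] := atom_a.
have [B [q [r [_ _ _ [r0 rinf] qpr]]]] := pl a (ltW a0).
have r_ge0 b : 0 <= r b by apply: r0; exists b.
have [b rb] : exists b, vmeet (r b) a <= e *: a.
  apply: contrapT => /forallNP nr; suff : e *: a <= 0.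
    by apply/negP; rewrite (lt_geF _)// vscaler_gt0.
  apply: rinf => _ [b _ <-]; have [t _ tE] := atom_meet atom_a (r_ge0 b).
  apply: le_trans (vmeet_lel _ a); have := nr b; rewrite tE !vler_pM2r//.
  by move=> /negP; rewrite -ltNge => /ltW.
have [i0 i0P] := qpr b; exists i0 => i /i0P/andP[_ ple].
by apply: le_trans rb; rewrite vmeet_glb ple vmeet_ler.
Qed.

Lemma atomic_uo_topological : atomic F -> uo_topological F.
Proof.
move=> atomF; exists (Topological.class (atom_topology F)) => T A p l.
split=> [pl|/cvg_atom_topologyP pl h h0].
  by apply/cvg_atom_topologyP => a atom_a e e0; exact: uo_cvg_atom.
apply: (order_cvg0 archF (h := h)) => [i|c c0].
  by rewrite vmeet_ler vmeet_ge0 ?vabs_ge0.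
(* An atom [a <= c] serves with [d = 2^-1 *: a]: convergence at [a] with radius [2^-1] eventually
   gives the bound that [atom_leD] requires. *)
have [a [/andP[a0 ac] atom_a]] := atomF c c0.
have half0 : 0 < 2^-1 :> R by rewrite invr_gt0.
exists (2^-1 *: a); first by rewrite vscaler_gt0//; case: atom_a.
have [i0 i0P] := pl a atom_a _ half0; exists i0 => i /i0P pa b pb cb.
apply: atom_leD => //; first by rewrite vmeet_ge0 ?vabs_ge0.
  by apply: le_trans pa; rewrite vle_meet ?vmeet_lel.
exact: le_trans cb.
Qed.

(* The analogue of the filter of dense open sets in the Stone space of w. *)
Definition dense_filter (w : F) : set_system F :=
  [set E | forall z, 0 < z <= w ->
     exists2 z', 0 < z' <= z & forall x, 0 < x <= z' -> E x].

Lemma dense_filter_proper w : 0 < w -> ProperFilter (dense_filter w).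
Proof.
move=> w0; apply: Build_ProperFilter_ex.
  move=> E /(_ w); rewrite w0 lexx => /(_ isT)[z /andP[z0 _] zE].
  by exists z; apply: zE; rewrite z0 lexx.
split.
- by move=> z /andP[z0 _]; exists z; rewrite ?z0 ?lexx.
- move=> D E dD dE z zw; have [z1 /andP[z10 z1z] z1D] := dD z zw.
  have [|z2 /andP[z20 z2z1] z2E] := dE z1.
    by rewrite z10 (le_trans z1z)//; case/andP: zw.
  exists z2; first by rewrite z20 (le_trans z2z1).
  move=> x /andP[x0 xz2]; split; last by apply: z2E; rewrite x0.
  by apply: z1D; rewrite x0 (le_trans xz2).
- by move=> D E DE dD z /dD[z' z'z z'D]; exists z' => // x /z'D/DE.
Qed.

(** Given [z], keep [z] if it is disjoint from [c1]; otherwise shrink to [vmeet z c1], which is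
    disjoint from [c2]. *)
Lemma dense_filter_split w c1 c2 : 0 <= c1 -> 0 <= c2 -> vmeet c1 c2 = 0 ->
  dense_filter w ([set x | 0 <= x /\ vmeet x c1 = 0] `|`
                  [set x | 0 <= x /\ vmeet x c2 = 0]).
Proof.
have shrink (x z c : F) : 0 <= c -> 0 < x <= z -> vmeet z c = 0 ->
    0 <= x /\ vmeet x c = 0.
  move=> c0 /andP[/ltW x0 xz] zc; split=> //.
  by apply: le_anti; rewrite vmeet_ge0// andbT -zc vle_meet.
move=> c10 c20 c12 z /andP[z0 _]; have [zc1|zc1] := eqVneq (vmeet z c1) 0.
  by exists z; [rewrite z0 lexx|move=> x xz; left; exact: shrink zc1].
exists (vmeet z c1); first by rewrite lt_def zc1 vmeet_ge0 ?vmeet_lel// ltW.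
move=> x /andP[x0 xz]; right; apply: shrink c12 => //.
by rewrite x0 (le_trans xz (vmeet_ler _ _)).
Qed.

Lemma uo_topological_atomic : uo_topological F -> atomic F.
Proof.
move=> [tau]; set T := Topological.Pack tau => /= tauP g g0.
apply: contrapT => /forallNP noatom.
have : uo_cvg (filter_net (@nbhs_pfilter T 0)) 0.
  by apply/tauP; rewrite (filter_net_tails (@nbhs_pfilter T 0)).
move=> /(_ g (ltW g0))[B [q [r0 [_ _ _ [r00 r0inf] qpr]]]].
have [b /negP nb] : exists b, ~ g <= r0 b.
  apply/existsNP => gr; suff : g <= 0 by rewrite (lt_geF g0).
  by apply: r0inf => _ [b _ <-].
have r_ge0 : 0 <= r0 b by apply: r00; exists b.
move: (r0 b) nb r_ge0 (qpr b) => r gr r_ge0 [[[U x0] [/= nbU Ux0]] UP].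
(* [UP] covers all pairs later than [(U, x0)]; as only sets are compared, these include [(U, x)] for
   each [x] in [U]. *)
have Ur x : U x -> vmeet (vlat_abs x) g <= r.
  move=> Ux; have /andP[_ le_r] := UP (exist _ (U, x) (conj nbU Ux)) (fun _ => id).
  by move: le_r; rewrite subr0.
pose w := vpos (g - r).
have w0 : 0 < w by rewrite vpos_gt0 vleBlDr add0r.
have [G [ultraG denseG]] := ultraFilterLemma (dense_filter_proper w0).
have properG : ProperFilter G by exact: ultra_proper.
have wg : w <= g by rewrite vpos_le ?(ltW g0)// vleBlDr vle_wpDr.
have Gw : G [set x | 0 < x <= w].
  apply: denseG => z /andP[z0 zw]; exists z; first by rewrite z0 lexx.
  by move=> x /andP[x0' xz]; rewrite /= x0' (le_trans xz).
have /choice[n nP] x : exists n, 0 < x <= w -> ~ vmeet (x *+ n) g <= r.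
  have [/andP[x0' xw]|nx] := boolP (0 < x <= w); last by exists 0%N.
  by have [n nP] := not_le_meet_mulrn archF r_ge0 x0' xw; exists n.
(* Some indices carry points outside [(0, w]]. Here [vpos] makes [y] nonnegative at every index and
   changes nothing on [(0, w]], a member of [G]. *)
pose y (u : filter_dset properG) := vpos (filter_net _ u) *+ n (filter_net _ u).
suff : uo_cvg y 0.
  (* Convergence would put the set of [x] with [U (vpos x *+ n x)] into [G]; a point of it in
     [(0, w]] contradicts the choice of [n x] by [Ur]. *)
  move=> /tauP/(_ U nbU).
  rewrite [X in X U -> _](_ : _ = (fun x => vpos x *+ n x) @ G); last first.
    by rewrite -[in RHS](filter_net_tails properG).
  rewrite /= -[X in X -> _]/(G [set x | U (vpos x *+ n x)]) => GU.
  have [x [xw Ux]] := filter_ex (filterI Gw GU).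
  case/andP: (xw) => /ltW x0' _; apply: (nP x xw).
  by have := Ur _ Ux; rewrite vpos_id// vabs_id// vmulrn_ge0.
apply: uo_cvg0_disjoint => // [u|c c0].
  by rewrite vmulrn_ge0 ?vpos_ge0.
(* Disjointness from [x] passes to its multiples, so the factors [n x] can be ignored. *)
suff [d dc Gd] : exists2 d, 0 < d <= c & G [set x | 0 <= x /\ vmeet x d = 0].
  exists d => //; rewrite -(filter_net_tails properG) in Gd.
  have [u0 u0P] := Gd; exists u0 => u /u0P[y0 yd].
  rewrite /y vpos_id// vmeetC vmeet0_mulrn 1?vmeetC//.
  by case/andP: dc => /ltW.
have [cw|cw] := eqVneq (vmeet w c) 0.
  exists c; first by rewrite c0 lexx.
  apply: filterS Gw => x /andP[/ltW x0' xw]; split=> //.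
  by apply: le_anti; rewrite vmeet_ge0 ?(ltW c0)// andbT -cw vle_meet.
(* The element [vmeet w c] is below [g], so it is no atom and splits into disjoint [c1] and [c2].
   The ultrafilter decides which of the two serves as [d]. *)
have cw0 : 0 < vmeet w c by rewrite lt_def vmeet_ge0 ?ltW// andbT.
have cw_natom : ~ atom (vmeet w c).
  move=> acw; apply: (noatom (vmeet w c)); split=> //.
  by rewrite ltW// (le_trans (vmeet_lel _ _)).
have [c1 [c2 [/andP[c10 c1c] /andP[c20 c2c] c12]]] :=
  non_atom_split archF cw0 cw_natom.
have := denseG _ (dense_filter_split (w := w) (ltW c10) (ltW c20) c12).
set C1 := [set x | _ /\ vmeet x c1 = 0]; set C2 := [set x | _ ] => GC.
have [GC1|GC1] := in_ultra_setVsetC C1 ultraG.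
  by exists c1 => //; rewrite c10 (le_trans c1c (vmeet_ler _ _)).
exists c2; first by rewrite c20 (le_trans c2c (vmeet_ler _ _)).
by apply: filterS (filterI GC GC1) => x [[]].
Qed.

End UoTopological.

Theorem corollary4p7 (R : realType) (F : vectorLatticeType R)
    (F_archimedean : archimedean F) :
  atomic F <-> uo_topological F.
Proof.
split; [exact: atomic_uo_topological|exact: uo_topological_atomic].
Qed.
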